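(* Let $\Delta: M_2(\mathbb{C})\to M_2(\mathbb{C})\otimes M_2(\mathbb{C})$ be a $q$-pure symmetric quasi quantum quadratic operator with Haar state $\tau$, where $\tau(x)=\frac12\mathrm{Tr}(x)$. Then $\Delta$ is not positive.
   Context: $\mathbf 1$ denotes the $2\times2$ identity matrix. For a linear map $\Delta: M_2(\mathbb{C})\to M_2(\mathbb{C})\otimes M_2(\mathbb{C})$ and a linear functional $\varphi$ on $M_2(\mathbb{C})$, define $V_\Delta(\varphi)=(\varphi\otimes\varphi)\circ\Delta$. A functional $\varphi$ is positive if $\varphi(x)\ge0$ whenever $x\ge0$ (positive semidefinite), and a state if moreover $\varphi(\mathbf 1)=1$. $\Delta$ is positive if $\Delta(x)\ge0$ whenever $x\ge0$. $\Delta$ is a quasi quantum quadratic operator if it is linear, unital ($\Delta(\mathbf 1)=\mathbf 1\otimes \mathbf 1$), $*$-preserving ($\Delta(x^* )=\Delta(x)^*$ for all $x$), and $V_\Delta(\varphi)$ is a positive functional whenever $\varphi$ is. It is symmetric if $U\Delta=\Delta$, where $U$ is the linear flip on $M_2(\mathbb{C})\otimes M_2(\mathbb{C})$ with $U(x\otimes y)=y\otimes x$. It is $q$-pure if $V_\Delta(\varphi)$ is a pure state for every pure state $\varphi$. A state $h$ is a Haar state for $\Delta$ if $(h\otimes \mathrm{id})\circ\Delta(x)=(\mathrm{id}\otimes h)\circ\Delta(x)=h(x)\mathbf 1$ for every $x\in M_2(\mathbb{C})$. *)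

(* Defs.v *)
From HB Require Import structures.
From mathcomp Require Import all_boot all_order all_algebra.
From mathcomp Require Import spectral complex mxtens.
From mathcomp Require Import reals.

Set Implicit Arguments.
Unset Strict Implicit.
Unset Printing Implicit Defensive.

Import Order.TTheory GRing.Theory Num.Theory.
Local Open Scope ring_scope.
Local Open Scope sesquilinear_scope.

(* M_m (x) M_n is identified with 'M_(m * n), a (x) b being the Kronecker
   product a *t b of mxtens; mxtens_index (i, k) is the index of the basis
   vector e_i (x) e_k. *)
Notation "A *t B" := (tensmx A B)
  (at level 40, left associativity, format "A  *t  B") : ring_scope.

Section Tensor.
Variables (C : numClosedFieldType) (m n : nat).

(* phi (x) id *)
Definition slicel (phi : {scalar 'M[C]_m}) (X : 'M[C]_(m * n)) : 'M[C]_n :=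
  \matrix_(k, l)
    phi (\matrix_(i, j) X (mxtens_index (i, k)) (mxtens_index (j, l))).

Lemma slicel_is_linear phi : linear (slicel phi).
Proof.
move=> a X Y; apply/matrixP=> k l; rewrite !mxE -linearP.
by congr (phi _); apply/matrixP=> i j; rewrite !mxE.
Qed.
HB.instance Definition _ phi :=
  GRing.isLinear.Build C 'M[C]_(m * n) 'M[C]_n *:%R (slicel phi)
    (slicel_is_linear phi).

Lemma slicel_tens phi (a : 'M[C]_m) (b : 'M[C]_n) :
  slicel phi (a *t b) = phi a *: b.
Proof.
apply/matrixP=> k l; rewrite !mxE mulrC -[RHS]linearZ.
congr (phi _); apply/matrixP=> i j.
by rewrite mxE tensmxE mxE mulrC.
Qed.

(* id (x) psi *)
Definition slicer (psi : {scalar 'M[C]_n}) (X : 'M[C]_(m * n)) : 'M[C]_m :=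
  \matrix_(i, j)
    psi (\matrix_(k, l) X (mxtens_index (i, k)) (mxtens_index (j, l))).

Lemma slicer_is_linear psi : linear (slicer psi).
Proof.
move=> a X Y; apply/matrixP=> i j; rewrite !mxE -linearP.
by congr (psi _); apply/matrixP=> k l; rewrite !mxE.
Qed.
HB.instance Definition _ psi :=
  GRing.isLinear.Build C 'M[C]_(m * n) 'M[C]_m *:%R (slicer psi)
    (slicer_is_linear psi).

Lemma slicer_tens psi (a : 'M[C]_m) (b : 'M[C]_n) :
  slicer psi (a *t b) = psi b *: a.
Proof.
apply/matrixP=> i j; rewrite !mxE mulrC -[RHS]linearZ.
by congr (psi _); apply/matrixP=> k l; rewrite mxE tensmxE mxE.
Qed.

(* phi (x) psi = psi o (phi (x) id) *)
Definition tensf (phi : {scalar 'M[C]_m}) (psi : {scalar 'M[C]_n}) :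
  {scalar 'M[C]_(m * n)} := psi \o slicel phi.

Lemma tensf_tens phi psi (a : 'M[C]_m) (b : 'M[C]_n) :
  tensf phi psi (a *t b) = phi a * psi b.
Proof. by rewrite /tensf /= slicel_tens linearZ. Qed.

Definition flip_index (p : 'I_(n * m)) : 'I_(m * n) :=
  mxtens_index ((mxtens_unindex p).2, (mxtens_unindex p).1).

Definition flip (X : 'M[C]_(m * n)) : 'M[C]_(n * m) :=
  \matrix_(p, q) X (flip_index p) (flip_index q).

Lemma flip_is_linear : linear flip.
Proof. by move=> a X Y; apply/matrixP=> p q; rewrite !mxE. Qed.
HB.instance Definition _ :=
  GRing.isLinear.Build C 'M[C]_(m * n) 'M[C]_(n * m) *:%R flip flip_is_linear.

Lemma flip_tens (a : 'M[C]_m) (b : 'M[C]_n) : flip (a *t b) = b *t a.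
Proof. by apply/matrixP=> p q; rewrite mxE tensmxE mxE mulrC. Qed.

End Tensor.

Section QuasiQQO.
Variable C : numClosedFieldType.

(* In a numClosedFieldType, 0 <= z means that z is real and nonnegative, so
   this condition forces x to be Hermitian. *)
Definition psdmx n (x : 'M[C]_n) : Prop :=
  forall v : 'cV[C]_n, 0 <= (v ^t* *m x *m v) 0 0.

Definition positive_functional (phi : {scalar 'M[C]_2}) : Prop :=
  forall x, psdmx x -> 0 <= phi x.

Definition state (phi : {scalar 'M[C]_2}) : Prop :=
  positive_functional phi /\ phi 1%:M = 1.

(* extreme point of the state space; 0 < t < 1 forces t to be real *)
Definition pure_state (phi : {scalar 'M[C]_2}) : Prop :=
  state phi /\
  forall (psi1 psi2 : {scalar 'M[C]_2}) (t : C),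
    state psi1 -> state psi2 -> 0 < t < 1 ->
    (forall x, phi x = t * psi1 x + (1 - t) * psi2 x) ->
    psi1 =1 phi /\ psi2 =1 phi.

Section Operator.
Variable Delta : {linear 'M[C]_2 -> 'M[C]_(2 * 2)}.

Definition V (phi : {scalar 'M[C]_2}) : {scalar 'M[C]_2} :=
  tensf phi phi \o Delta.

Definition positive_map : Prop := forall x, psdmx x -> psdmx (Delta x).

Definition quasi_qqo : Prop :=
  [/\ Delta 1%:M = 1%:M *t 1%:M,
      forall x, Delta (x ^t*) = (Delta x) ^t* &
      forall phi, positive_functional phi -> positive_functional (V phi)].

Definition symmetric_qqo : Prop := forall x, flip (Delta x) = Delta x.

Definition q_pure : Prop := forall phi, pure_state phi -> pure_state (V phi).

Definition haar_state (h : {scalar 'M[C]_2}) : Prop :=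
  state h /\
  forall x, slicel h (Delta x) = h x *: 1%:M /\
            slicer h (Delta x) = h x *: 1%:M.

End Operator.

Definition tau_fun (x : 'M[C]_2) : C := 2^-1 * \tr x.

Lemma tau_is_scalar : scalar tau_fun.
Proof. by move=> a x y; rewrite /tau_fun linearP mulrDr mulrCA. Qed.
HB.instance Definition _ :=
  GRing.isLinear.Build C 'M[C]_2 C *%R tau_fun tau_is_scalar.

Definition tau : {scalar 'M[C]_2} := tau_fun.

End QuasiQQO.

(* Main.v *)
(* Write P_u = u u^* for a unit vector u of C^2, and w for a unit vector orthogonal
   to u.  The functional V(P_u) is a pure state, so there is a projection p of
   trace 1 with V(P_u)(1 - p) = 0.  If Delta is positive, X = Delta p and 1 - X are
   positive semidefinite, and X fixes u (x) u.  The Haar property gives X partial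
   traces equal to 1; hence the diagonal entries of X at w (x) u and u (x) w vanish
   and the one at w (x) w is 1, which forces X = P_u (x) P_u + P_w (x) P_w, i.e.
   (1 + s (x) s) / 2 for the spin s = P_u - P_w in direction u.  So the range of
   Delta contains 1 (x) 1 and all the s (x) s, five of which are already linearly
   independent, while the domain of Delta has dimension 4. *)
From HB Require Import structures.
Require Import Defs.
From mathcomp Require Import all_boot all_order all_algebra.
From mathcomp Require Import spectral complex mxtens reals.
From mathcomp Require Import ring.

Set Implicit Arguments.
Unset Strict Implicit.
Unset Printing Implicit Defensive.

Import Order.TTheory GRing.Theory Num.Theory.
Local Open Scope ring_scope.
Local Open Scope sesquilinear_scope.

(** * Adjoints and positive semidefinite matrices *)

Section PositiveMatrices.
Variable C : numClosedFieldType.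

Lemma adjmxM m n p (A : 'M[C]_(m, n)) (B : 'M[C]_(n, p)) :
  (A *m B) ^t* = B ^t* *m A ^t*.
Proof. by rewrite trmx_mul map_mxM. Qed.

Lemma adjmxD m n (A B : 'M[C]_(m, n)) : (A + B) ^t* = A ^t* + B ^t*.
Proof. by rewrite linearD map_mxD. Qed.

Lemma adjmxZ m n s (A : 'M[C]_(m, n)) : (s *: A) ^t* = s^* *: A ^t*.
Proof. by rewrite linearZ map_mxZ. Qed.

Lemma adjmx_tens m n p q (A : 'M[C]_(m, n)) (B : 'M[C]_(p, q)) :
  (A *t B) ^t* = A ^t* *t B ^t*.
Proof. by rewrite trmx_tens map_mxT. Qed.

Lemma tensmxDr m n p q (A : 'M[C]_(m, n)) (B D : 'M[C]_(p, q)) :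
  A *t (B + D) = A *t B + A *t D.
Proof. by apply/matrixP=> i j; rewrite !mxE mulrDr. Qed.

Lemma tensmxDl m n p q (A D : 'M[C]_(m, n)) (B : 'M[C]_(p, q)) :
  (A + D) *t B = A *t B + D *t B.
Proof. by apply/matrixP=> i j; rewrite !mxE mulrDl. Qed.

(** The expression is real at [s = 1] and at [s = 'i], so [b + c] and ['i * (c - b)] are real; the
    two conjugation identities add up to the claim. *)
Lemma quadratic_ge0_conj (a b c d : C) : 0 <= a -> 0 <= d ->
  (forall s, 0 <= s^* * s * a + s^* * b + s * c + d) -> c = b^*.
Proof.
have real (z : C) : 0 <= z -> z^* = z by move=> /ger0_real/CrealP.
move=> /real aJ /real dJ hs.
have := real _ (hs 1); rewrite !rmorphD !rmorphM !rmorph1 /= !mul1r aJ dJ => h1.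
have := real _ (hs 'i).
rewrite !rmorphD !rmorphM /= conjCK conjCi aJ dJ => hi.
have hb : b^* + c^* = b + c.
  by apply: (addrI a); apply: (addIr d); rewrite !addrA.
have hc : b^* - c^* = c - b.
  apply: (mulfI (neq0Ci C)); apply: (addrI ('i * - 'i * a + d)).
  by apply: etrans (etrans _ hi) _; ring.
apply: (mulfI (_ : 2 != 0)); first by rewrite pnatr_eq0.
transitivity (b + c + (c - b)); first by ring.
by rewrite -hb -hc; ring.
Qed.

Lemma quadratic_ge0_eq0 (a b : C) : 0 <= a ->
  (forall s, 0 <= s^* * s * a + s^* * b + s * b^*) -> b = 0.
Proof.
move=> a_ge0 hs; have aJ : a^* = a by apply/CrealP; exact: ger0_real.
apply/eqP/negPn/negP=> b_neq0.
have a1_gt0 : 0 < a + 1 by rewrite ltr_wpDl.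
have tJ : ((a + 1)^-1)^* = (a + 1)^-1 by rewrite fmorphV rmorphD rmorph1 /= aJ.
have nb_gt0 : 0 < b^* * b by rewrite mulrC mul_conjC_gt0.
(* The minimiser [- b / a] is undefined when [a = 0]; with [a + 1] as denominator the value is still
   negative unless [b = 0]. *)
have := hs (- ((a + 1)^-1 * b)); rewrite rmorphN rmorphM /= tJ.
have -> : - ((a + 1)^-1 * b^*) * - ((a + 1)^-1 * b) * a +
   - ((a + 1)^-1 * b^*) * b + - ((a + 1)^-1 * b) * b^* =
   (a + 1)^-2 * (b^* * b) * - (a + 2).
  by field; rewrite gt_eqF.
rewrite pmulr_rge0 ?oppr_ge0; last by rewrite mulr_gt0 // invr_gt0 exprn_gt0.
by apply/negP; rewrite lt_geF // ltr_wpDl.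
Qed.

Lemma psdmx_quadratic n (x : 'M[C]_n) (u v : 'cV_n) s : psdmx x ->
  0 <= s^* * s * (u ^t* *m x *m u) 0 0 + s^* * (u ^t* *m x *m v) 0 0 +
       s * (v ^t* *m x *m u) 0 0 + (v ^t* *m x *m v) 0 0.
Proof.
move=> /(_ (s *: u + v)).
rewrite adjmxD adjmxZ !(mulmxDl, mulmxDr) -!scalemxAl -!scalemxAr.
have addE (A B : 'M[C]_1) : (A + B) 0 0 = A 0 0 + B 0 0 by rewrite mxE.
have scaleE a (A : 'M[C]_1) : (a *: A) 0 0 = a * A 0 0 by rewrite mxE.
by rewrite !(addE, scaleE); congr (0 <= _); ring.
Qed.

(** Polarization: nonnegativity of the quadratic form along [s *: u + v] already forces Hermitian
    symmetry, which [psdmx] does not state. *)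
Lemma psdmx_conj n (x : 'M[C]_n) (u v : 'cV_n) : psdmx x ->
  (v ^t* *m x *m u) 0 0 = ((u ^t* *m x *m v) 0 0)^*.
Proof.
move=> psd_x; apply: quadratic_ge0_conj (psd_x u) (psd_x v) _ => s.
exact: psdmx_quadratic.
Qed.

Lemma mxE_delta n (x : 'M[C]_n) i j :
  ((delta_mx i 0 : 'cV_n) ^t* *m x *m (delta_mx j 0 : 'cV_n)) 0 0 = x i j.
Proof.
rewrite mxE (bigD1 j) //= big1 ?addr0 => [|k kj]; last first.
  by rewrite [delta_mx _ _ _ _]mxE (negPf kj) mulr0.
rewrite mxE (bigD1 i) //= big1 ?addr0 => [|k ki].
  by rewrite !mxE !eqxx conjC1 mul1r mulr1.
by rewrite !mxE (negPf ki) conjC0 mul0r.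
Qed.

Lemma psdmx_adj n (x : 'M[C]_n) : psdmx x -> x ^t* = x.
Proof.
move=> psd_x; apply/matrixP=> i j; rewrite !mxE.
by rewrite -[x j i]mxE_delta -psdmx_conj ?mxE_delta.
Qed.

(** Along [s *: delta_mx i 0 + v] the form has no constant term, so nonnegativity for all [s] kills
    its cross coefficient, which is entry [i] of [x *m v]. *)
Lemma psdmx_ker n (x : 'M[C]_n) (v : 'cV[C]_n) : psdmx x ->
  (v ^t* *m x *m v) 0 0 = 0 -> x *m v = 0.
Proof.
move=> psd_x v0; apply/matrixP=> i j; rewrite ord1 [RHS]mxE.
have -> : (x *m v) i 0 = ((delta_mx i 0 : 'cV_n) ^t* *m x *m v) 0 0.
  rewrite -mulmxA [RHS]mxE (bigD1 i) //= big1 ?addr0 => [|k ki].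
    by rewrite !mxE !eqxx conjC1 mul1r.
  by rewrite !mxE (negPf ki) conjC0 mul0r.
apply: quadratic_ge0_eq0 (psd_x (delta_mx i 0)) _ => s.
have := psdmx_quadratic (delta_mx i 0) v s psd_x.
by rewrite v0 addr0 (psdmx_conj (delta_mx i 0) v).
Qed.

Lemma psdmx_adj_mul m n (A : 'M[C]_(m, n)) : psdmx (A ^t* *m A).
Proof.
move=> v; rewrite mulmxA -adjmxM -mulmxA mxE sumr_ge0 // => i _.
by rewrite !mxE mulrC mul_conjC_ge0.
Qed.

Lemma psdmx_proj n (x : 'M[C]_n) : x ^t* = x -> x *m x = x -> psdmx x.
Proof. by move=> xJ xx; rewrite -xx -{1}xJ; apply: psdmx_adj_mul. Qed.

(** * Linear functionals as traces against a density matrix *)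

Definition densf n (a x : 'M[C]_n) : C := \tr (a *m x).

Lemma densf_is_scalar n (a : 'M[C]_n) : scalar (densf a).
Proof. by move=> s x y; rewrite /densf mulmxDr -scalemxAr linearP. Qed.
HB.instance Definition _ n (a : 'M[C]_n) :=
  GRing.isLinear.Build C 'M[C]_n C *%R (densf a) (densf_is_scalar a).

Lemma densfDl n (a b x : 'M[C]_n) : densf (a + b) x = densf a x + densf b x.
Proof. by rewrite /densf mulmxDl linearD. Qed.

Lemma densfZl n s (a x : 'M[C]_n) : densf (s *: a) x = s * densf a x.
Proof. by rewrite /densf -scalemxAl linearZ. Qed.

Lemma densf_vec n (u : 'cV[C]_n) (x : 'M[C]_n) :
  densf (u *m u ^t*) x = (u ^t* *m x *m u) 0 0.
Proof. by rewrite /densf -mulmxA mxtrace_mulC /mxtrace big_ord1. Qed.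

(** The indices are swapped because the trace of [a *m delta_mx j i] is [a i j]. *)
Definition density n (phi : {scalar 'M[C]_n}) : 'M[C]_n :=
  \matrix_(i, j) phi (delta_mx j i).

Lemma densityE n (phi : {scalar 'M[C]_n}) x : phi x = densf (density phi) x.
Proof.
rewrite {1}(matrix_sum_delta x) linear_sum /densf /mxtrace /=.
under eq_bigr do rewrite linear_sum; rewrite exchange_big; apply: eq_bigr => j _.
by rewrite mxE; apply: eq_bigr => i _; rewrite linearZ /= mxE mulrC.
Qed.

Lemma psdmx_vec n (u : 'cV[C]_n) : psdmx (u *m u ^t*).
Proof. by rewrite -{1}[u]trmxCK; apply: psdmx_adj_mul. Qed.

(** * Kronecker products and slices under the trace pairing *)

Lemma sum_mxtens m n (F : 'I_(m * n) -> C) :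
  \sum_p F p = \sum_i \sum_k F (mxtens_index (i, k)).
Proof.
rewrite pair_big /= (reindex (@mxtens_index m n)) /=.
  by apply: eq_bigr => -[].
by exists (@mxtens_unindex m n) => p _; rewrite (mxtens_indexK, mxtens_unindexK).
Qed.

Lemma tensmxZl m n p q s (A : 'M[C]_(m, n)) (B : 'M[C]_(p, q)) :
  (s *: A) *t B = s *: (A *t B).
Proof. by apply/matrixP=> i j; rewrite !mxE mulrA. Qed.

Lemma tensmxZr m n p q s (A : 'M[C]_(m, n)) (B : 'M[C]_(p, q)) :
  A *t (s *: B) = s *: (A *t B).
Proof. by apply/matrixP=> i j; rewrite !mxE mulrCA. Qed.

Lemma tensmx1 m n : 1%:M *t 1%:M = 1%:M :> 'M[C]_(m * n).
Proof.
apply/matrixP=> i j; case: (mxtens_indexP i) => i0 i1.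
case: (mxtens_indexP j) => j0 j1; rewrite tensmxE !mxE -natrM mulnb.
by rewrite (can_eq (@mxtens_indexK m n)).
Qed.

Lemma densf_tens m n (a : 'M[C]_m) (b : 'M[C]_n) (X : 'M[C]_(m * n)) :
  densf (a *t b) X = \sum_i \sum_k \sum_j \sum_l
    a i j * b k l * X (mxtens_index (j, l)) (mxtens_index (i, k)).
Proof.
rewrite /densf /mxtrace sum_mxtens; apply: eq_bigr => i _.
apply: eq_bigr => k _; rewrite mxE sum_mxtens; apply: eq_bigr => j _.
by apply: eq_bigr => l _; rewrite tensmxE.
Qed.

(** Turns product functionals into traces against [a *t b], where bilinearity in [a] and [b] can be
    exploited. *)
Lemma densf_slicel m n (a : 'M[C]_m) (b : 'M[C]_n) (X : 'M[C]_(m * n)) :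
  densf b (slicel (densf a) X) = densf (a *t b) X.
Proof.
rewrite densf_tens exchange_big /densf /mxtrace; apply: eq_bigr => k _ /=.
rewrite mxE; under [RHS]eq_bigr do rewrite exchange_big.
rewrite [RHS]exchange_big; apply: eq_bigr => l _ /=.
rewrite mxE mulr_sumr; apply: eq_bigr => i _.
rewrite mxE mulr_sumr; apply: eq_bigr => j _.
by rewrite mxE mulrCA mulrA.
Qed.

Lemma densf_slicer m n (a : 'M[C]_m) (b : 'M[C]_n) (X : 'M[C]_(m * n)) :
  densf a (slicer (densf b) X) = densf (a *t b) X.
Proof.
rewrite densf_tens /densf /mxtrace; apply: eq_bigr => i _ /=.
rewrite mxE exchange_big; apply: eq_bigr => j _ /=.
rewrite mxE mulr_sumr; apply: eq_bigr => k _.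
by rewrite mxE mulr_sumr; apply: eq_bigr => l _; rewrite mxE mulrA.
Qed.

End PositiveMatrices.

(** * Orthonormal bases and pure states in dimension 2 *)

Section Qubit.
Variable C : numClosedFieldType.
Implicit Types (u : 'cV[C]_2) (x p : 'M[C]_2) (phi : {scalar 'M[C]_2}).

Lemma sum2 (F : 'I_2 -> C) : \sum_i F i = F 0 + F 1.
Proof.
by rewrite big_ord_recl big_ord1; congr (_ + F _); apply: val_inj.
Qed.

Lemma ord2_ind (P : 'I_2 -> Prop) : P 0 -> P 1 -> forall i, P i.
Proof.
move=> P0 P1 [[|[|//]] lti].
  by rewrite (_ : Ordinal lti = 0) //; apply: val_inj.
by rewrite (_ : Ordinal lti = 1) //; apply: val_inj.
Qed.

Lemma tr2 x : \tr x = x 0 0 + x 1 1.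
Proof. exact: sum2. Qed.

Lemma mulmx2E m n (A : 'M[C]_(m, 2)) (B : 'M[C]_(2, n)) i j :
  (A *m B) i j = A i 0 * B 0 j + A i 1 * B 1 j.
Proof. by rewrite mxE sum2. Qed.

Definition perp u : 'cV[C]_2 :=
  \col_i (if i == 0 then - (u 1 0)^* else (u 0 0)^*).

Section Orthobasis.
Variable u : 'cV[C]_2.
Hypothesis u1 : u ^t* *m u = 1%:M.
Let w := perp u.

Let u1E : (u 0 0)^* * u 0 0 + (u 1 0)^* * u 1 0 = 1.
Proof.
by have /matrixP/(_ 0 0) := u1; rewrite mulmx2E !mxE.
Qed.

Lemma perp_orth : u ^t* *m w = 0.
Proof. by apply/matrixP=> i j; rewrite !ord1 mulmx2E !mxE /=; ring. Qed.

Lemma perp_unit : w ^t* *m w = 1%:M.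
Proof.
apply/matrixP=> i j; rewrite !ord1 mulmx2E !mxE /= -[RHS]u1E.
by rewrite !rmorphN /= !conjCK; ring.
Qed.

Lemma perp_complete : u *m u ^t* + w *m w ^t* = 1%:M.
Proof.
apply/matrixP; elim/ord2_ind; elim/ord2_ind;
  rewrite mxE !(mxE, big_ord1) /= ?rmorphN /= ?conjCK -?u1E; ring.
Qed.

End Orthobasis.

(** The quadratic form of the density at [v] is the value of [phi] at the positive matrix
    [v *m v ^t*]. *)
Lemma density_psd phi : positive_functional phi -> psdmx (density phi).
Proof.
move=> pos v; rewrite -densf_vec /densf mxtrace_mulC -/(densf _ _) -densityE.
exact/pos/psdmx_vec.
Qed.

Lemma densf_vec_state u : u ^t* *m u = 1%:M -> state (densf (u *m u ^t*)).
Proof.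
move=> u1; split=> [x psd_x|]; rewrite /= densf_vec; first exact: psd_x.
by rewrite mulmx1 u1 mxE.
Qed.

(** The density is positive and kills [perp u], so compressing it on both sides by [u *m u ^t*]
    leaves it unchanged. It is thus a multiple of that projection, and normalization makes the
    factor 1. *)
Lemma state_eq_densf_vec phi u : u ^t* *m u = 1%:M -> state phi ->
  phi (perp u *m (perp u) ^t*) = 0 -> phi =1 densf (u *m u ^t*).
Proof.
move=> u1 [pos phi1] phiw; have psd := density_psd pos.
have rw : density phi *m perp u = 0.
  apply: psdmx_ker => //.
  by rewrite -densf_vec /densf mxtrace_mulC -/(densf _ _) -densityE.
have wr : (perp u) ^t* *m density phi = 0.
  by rewrite -[in LHS](psdmx_adj psd) -adjmxM rw trmx0 map_mx0.
have E : density phi = (u ^t* *m density phi *m u) 0 0 *: (u *m u ^t*).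
  have right : density phi = density phi *m (u *m u ^t*).
    rewrite -{1}[density phi]mulmx1 -(perp_complete u1) mulmxDr.
    by rewrite [X in _ + X]mulmxA rw mul0mx addr0.
  have left : density phi = u *m u ^t* *m density phi.
    rewrite -{1}[density phi]mul1mx -(perp_complete u1) mulmxDl.
    by rewrite -[X in _ + X]mulmxA wr mulmx0 addr0.
  transitivity (u *m (u ^t* *m density phi *m u) *m u ^t*).
    by rewrite {1}left {1}right !mulmxA.
  by rewrite {1}[_ *m _ *m u]mx11_scalar mul_mx_scalar -scalemxAl.
move: ((u ^t* *m density phi *m u) 0 0) E => c E x.
rewrite densityE E densfZl; move: phi1; rewrite densityE E densfZl.
by rewrite (densf_vec_state u1).2 mulr1 => ->; rewrite mul1r.
Qed.

(** Both components of a mixture are nonnegative on the projection onto [perp u], where the mixture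
    vanishes; as the weights are positive, both components vanish there too. *)
Lemma densf_vec_pure u : u ^t* *m u = 1%:M -> pure_state (densf (u *m u ^t*)).
Proof.
move=> u1; split; first exact: densf_vec_state.
move=> psi1 psi2 t s1 s2 /andP[t0 t1] phiE.
have t1' : 0 < 1 - t by rewrite subr_gt0.
have psdw := psdmx_vec (perp u).
have := phiE (perp u *m (perp u) ^t*).
rewrite /= densf_vec mulmxA perp_orth // !mul0mx mxE => /esym/eqP.
have p1 := s1.1 _ psdw; have p2 := s2.1 _ psdw.
rewrite paddr_eq0; [|by rewrite mulr_ge0 // ltW|by rewrite mulr_ge0 // ltW].
rewrite !mulf_eq0 (gt_eqF t0) (gt_eqF t1') /= => /andP[/eqP z1 /eqP z2].
by split; apply: state_eq_densf_vec.
Qed.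

(* Otherwise det > 0, and subtracting (det / r00) E_11 from the density matrix r
   leaves a rank-one positive matrix: phi is a nontrivial mixture. *)
Lemma pure_density_det phi : pure_state phi ->
  density phi 0 0 * density phi 1 1 = density phi 0 1 * density phi 1 0.
Proof.
move=> [st_phi ext]; have psd := density_psd st_phi.1.
move: (density phi) psd (densityE phi) => r psd densE; set a := r 0 0.
have rJ : r 0 1 = (r 1 0)^*.
  by rewrite -{1}(psdmx_adj psd) !mxE.
have tr_r : a + r 1 1 = 1.
  by rewrite -tr2 -st_phi.2 densE /densf mulmx1.
have a_ge0 : 0 <= a by rewrite /a -mxE_delta; apply: psd.
have aJ : a^* = a by apply/CrealP; exact: ger0_real.
have [a0|a_neq0] := eqVneq a 0.
  (* A zero diagonal entry of a positive matrix forces its whole column to vanish. *)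
  have r0 : r *m delta_mx 0 0 = 0 :> 'cV_2 by apply: psdmx_ker; rewrite ?mxE_delta.
  have /matrixP/(_ 1 0) := r0; rewrite mulmx2E !mxE /= mulr1 mulr0 addr0 => ->.
  by rewrite a0 mul0r mulr0.
have a_gt0 : 0 < a by rewrite lt_def a_neq0.
apply/eqP; rewrite -subr_eq0; apply/negPn/negP => D_neq0.
set D := _ - _ in D_neq0.
have D_gt0 : 0 < D.
  rewrite lt_def D_neq0 -(pmulr_rge0 _ a_gt0).
  (* At this vector the quadratic form equals [a * D]. *)
  have := psd (\col_i (if i == 0 then - r 0 1 else a)).
  rewrite !mulmx2E !mxE /= rmorphN /= rJ conjCK aJ.
  by congr (0 <= _); rewrite /D rJ -/a; ring.
pose t := 1 - D / a.
have t_gt0 : 0 < t.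
  have -> : t = (a ^+ 2 + r 1 0 * (r 1 0)^*) / a.
    rewrite /t /D -rJ -/a; have -> : r 1 1 = 1 - a by rewrite -tr_r; ring.
    by field.
  by rewrite divr_gt0 // ltr_wpDr ?mul_conjC_ge0 ?exprn_gt0.
have t_lt1 : t < 1 by rewrite gtrBl divr_gt0.
have [f fE] : exists f : 'cV[C]_2, forall i, f i 0 = r i 0.
  by exists (col 0 r) => i; rewrite mxE.
pose e : 'cV[C]_2 := delta_mx 1 0.
have e1 : e ^t* *m e = 1%:M.
  by apply/matrixP=> i j; rewrite !ord1 mulmx2E !mxE /= conjC0 conjC1; ring.
have rE : r = t *: ((a^-1 * t^-1) *: (f *m f ^t*)) + (1 - t) *: (e *m e ^t*).
  have -> : 1 - t = D / a by rewrite /t; ring.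
  rewrite scalerA mulrCA mulfV ?gt_eqF // mulr1.
  apply/matrixP; elim/ord2_ind; elim/ord2_ind;
    rewrite !mxE !big_ord1 !mxE !fE /= ?conjC0 ?conjC1 /D -?rJ -/a ?aJ; by field.
have phiE x : phi x = t * densf ((a^-1 * t^-1) *: (f *m f ^t*)) x +
    (1 - t) * densf (e *m e ^t*) x.
  by rewrite densE {1}rE densfDl !densfZl.
have st_f : state (densf ((a^-1 * t^-1) *: (f *m f ^t*))).
  split=> [x psd_x|].
    rewrite /= densfZl densf_vec mulr_ge0 ?psd_x //.
    by rewrite mulr_ge0 // invr_ge0 ltW.
  apply: (mulfI (lt0r_neq0 t_gt0)); apply: (addIr (1 - t)).
  have := phiE 1%:M; rewrite st_phi.2 (densf_vec_state e1).2 mulr1 => <-.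
  by rewrite mulr1; ring.
have t01 : 0 < t < 1 by rewrite t_gt0.
(* Extremality would identify [phi] with the vector state of [e], which vanishes at [delta_mx 0 0],
   whereas [phi] takes the value [a] there. *)
have [_ eqe] := ext _ _ _ st_f (densf_vec_state e1) t01 phiE.
have := eqe (delta_mx 0 0 : 'M_2).
rewrite densE /= /densf !tr2 !mulmx2E !mxE !big_ord1 !mxE /= -/a => a0.
by case/eqP: a_neq0; move: a0; rewrite !(mul0r, mulr0, mulr1, addr0).
Qed.

(** The witness is the density itself: with trace 1 and determinant 0, Cayley-Hamilton makes it
    idempotent. *)
Lemma pure_state_proj phi : pure_state phi ->
  exists p, [/\ psdmx p, psdmx (1%:M - p), \tr p = 1 & phi (1%:M - p) = 0].
Proof.
move=> pure; have det := pure_density_det pure; have [[pos phi1] _] := pure.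
have psd := density_psd pos; set r := density phi in det psd *.
have tr_r : \tr r = 1 by rewrite -phi1 densityE /densf mulmx1.
have r11 : r 1 1 = 1 - r 0 0 by rewrite -tr_r tr2; ring.
have rr : r *m r = r.
  by apply/matrixP; elim/ord2_ind; elim/ord2_ind;
    rewrite mulmx2E 1?(mulrC (r 1 0)) -?det r11; ring.
exists r; split=> //; last first.
  by rewrite densityE -/r /densf mulmxBr rr mulmx1 subrr linear0.
apply: psdmx_proj; last by rewrite mulmxBl mul1mx mulmxBr mulmx1 rr subrr subr0.
rewrite -scaleN1r adjmxD adjmxZ (psdmx_adj psd) rmorphN /= conjC1.
by rewrite trmx1 map_mx1.
Qed.


(** The tensor product of the two rank-one matrices is the rank-one matrix of the vector [a *t b],
    so [psdmx_ker] applies to that vector. *)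
Lemma psdmx_ker_tens m n (a : 'cV[C]_m) (b : 'cV[C]_n) (X : 'M[C]_(m * n)) :
  psdmx X -> densf ((a *m a ^t*) *t (b *m b ^t*)) X = 0 ->
  X *m ((a *m a ^t*) *t (b *m b ^t*)) = 0.
Proof.
rewrite -tensmx_mul -adjmx_tens => psd_X.
rewrite (densf_vec (a *t b : 'cV_(m * n))) => /(psdmx_ker psd_X).
by rewrite mulmxA => ->; rewrite mul0mx.
Qed.

Lemma tr_proj u : u ^t* *m u = 1%:M -> \tr (u *m u ^t*) = 1.
Proof. by move=> u1; rewrite mxtrace_mulC u1 mxtrace1. Qed.

(** * Linear dependence and rational unit vectors *)

Lemma linear_dependent m n k (A : 'I_k -> 'M[C]_(m, n)) : (m * n < k)%N ->
  exists2 c : 'rV[C]_k, c != 0 & \sum_i c 0 i *: A i = 0.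
Proof.
move=> ltmnk; pose M := \matrix_i mxvec (A i).
(* [M] has [k] rows but only [m * n] columns, so its left kernel is nonzero. *)
have : kermx M != 0.
  by rewrite kermx_eq0 -row_leq_rank -ltnNge (leq_ltn_trans (rank_leq_col M)).
case/rowV0Pn=> c /sub_kermxP cM c_neq0; exists c => //.
apply: (can_inj mxvecK); rewrite linear0 -cM mulmx_sum_row linear_sum.
by apply: eq_bigr => i _; rewrite linearZ rowK.
Qed.

(* Taking z = 1, -1, 'i yields three Bloch vectors with nonzero third component and
   rational coordinates, so that no square roots are needed. *)
Definition qvec z : 'cV[C]_2 := \col_i (if i == 0 then 3 / 5 else 4 / 5 * z).

Lemma qvec_unit z : z * z^* = 1 -> (qvec z) ^t* *m qvec z = 1%:M.
Proof.
move=> z1; apply/matrixP=> i j; rewrite !ord1 mulmx2E !mxE /=.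
rewrite !rmorphM !fmorphV /= !conjC_nat.
transitivity (9 / 25 + 16 / 25 * (z * z^*)); first by field.
by rewrite z1; field.
Qed.

Lemma qvecE z : let q := qvec z *m (qvec z) ^t* in
  [/\ q 0 0 = 9 / 25, q 0 1 = 12 / 25 * z^*, q 1 0 = 12 / 25 * z &
      q 1 1 = 16 / 25 * (z * z^*)].
Proof.
split; rewrite !mxE !big_ord1 !mxE /= ?rmorphM !fmorphV /= !conjC_nat; by field.
Qed.

(** * Positive q-pure operators with Haar state [tau] *)

Section Operator.
Variable Delta : {linear 'M[C]_2 -> 'M[C]_(2 * 2)}.
Hypothesis haar : haar_state Delta (tau C).

Let tauE x : tau C x = densf (2^-1 *: 1%:M) x.
Proof. by rewrite densfZl /densf mul1mx. Qed.

(** Twice the Haar identity says that the partial trace of [Delta x] is [\tr x] times the identity;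
    this is that identity paired with [b]. *)
Lemma haar_densfl b x : densf (1%:M *t b) (Delta x) = \tr x * \tr b.
Proof.
have [/(congr1 (densf b)) + _] := haar.2 x.
(* A slice depends only on the values of its functional, so [tau] may be traded for its density
   form. *)
have -> : slicel (tau C) (Delta x) = slicel (densf (2^-1 *: 1%:M)) (Delta x).
  by apply/matrixP=> i j; rewrite [LHS]mxE [RHS]mxE tauE.
rewrite densf_slicel linearZ /= tensmxZl densfZl.
rewrite tauE densfZl -mulrA.
have /mulfI inj : 2^-1 != 0 :> C by rewrite invr_eq0 pnatr_eq0.
by move/inj => ->; rewrite /densf mulmx1 mul1mx.
Qed.

Lemma haar_densfr a x : densf (a *t 1%:M) (Delta x) = \tr x * \tr a.
Proof.
have [_ /(congr1 (densf a))] := haar.2 x.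
have -> : slicer (tau C) (Delta x) = slicer (densf (2^-1 *: 1%:M)) (Delta x).
  by apply/matrixP=> i j; rewrite [LHS]mxE [RHS]mxE tauE.
rewrite densf_slicer linearZ /= tensmxZr densfZl.
rewrite tauE densfZl -mulrA.
have /mulfI inj : 2^-1 != 0 :> C by rewrite invr_eq0 pnatr_eq0.
by move/inj => ->; rewrite /densf mulmx1 mul1mx.
Qed.

Hypothesis qqo : quasi_qqo Delta.
Hypothesis pure : q_pure Delta.
Hypothesis pos : positive_map Delta.

(** The four products of [q] and [r] sum to the identity. [X] annihilates the two mixed ones and
    fixes the other two, hence equals the sum of those two. *)
Lemma Delta_image u : u ^t* *m u = 1%:M -> let q := u *m u ^t* in
  exists p, Delta p = q *t q + (1%:M - q) *t (1%:M - q).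
Proof.
move=> u1 q; pose r := perp u *m (perp u) ^t*; have [Delta1 _ _] := qqo.
have [p [psd_p psd_p' tr_p Vp']] := pure_state_proj (pure (densf_vec_pure u1)).
exists p; have psdX := pos psd_p; have := pos psd_p'.
have qr : q + r = 1%:M := perp_complete u1.
have -> : 1%:M - q = r by rewrite -qr addrC addKr.
have trq : \tr q = 1 by apply: tr_proj.
have trr : \tr r = 1 by apply/tr_proj/perp_unit.
have densf1 a b : densf (a *t b) (1%:M *t 1%:M) = \tr a * \tr b.
  by rewrite -densf_slicel slicel_tens linearZ /= /densf !mulmx1.
have hl := haar_densfl _ p; have hr := haar_densfr _ p.
rewrite tr_p in hl hr.
move: Vp'; rewrite /= -/q densf_slicel linearB /= Delta1.
set X := Delta p in hl hr psdX *; set Y := _ - X => Yqq psdY.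
have Xqq : densf (q *t q) X = 1.
  by move/eqP: Yqq; rewrite linearB /= densf1 trq mulr1 subr_eq0 => /eqP.
have Xrq : densf (r *t q) X = 0.
  by apply: (addrI 1); rewrite -{1}Xqq -densfDl -tensmxDl qr hl trq mulr1 addr0.
have Xqr : densf (q *t r) X = 0.
  by apply: (addrI 1); rewrite -{1}Xqq -densfDl -tensmxDr qr hr trq mulr1 addr0.
have Yrr : densf (r *t r) Y = 0.
  rewrite /Y linearB /= densf1 trr -[densf _ X]add0r -{1}Xqr -densfDl.
  by rewrite -tensmxDl qr hl trr subrr.
(* Since [Y] is the identity minus [X], whatever [Y] annihilates is fixed by [X]. *)
have XE a : Y *m a = 0 -> X *m a = a.
  by rewrite mulmxBl tensmx1 mul1mx => /eqP; rewrite subr_eq0 => /eqP/esym.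
rewrite -[LHS]mulmx1 -tensmx1 -qr tensmxDl !tensmxDr !mulmxDr.
rewrite (psdmx_ker_tens psdX Xqr) (psdmx_ker_tens psdX Xrq) addr0 add0r.
by rewrite !XE //; apply: psdmx_ker_tens.
Qed.

(** [Delta] carries a linear relation among five elements of a 4-dimensional space to one among
    their images; entrywise, that relation turns out to be trivial. *)
Lemma pure_haar_positive_absurd : False.
Proof.
pose e : 'cV[C]_2 := delta_mx 0 0.
have e1 : e ^t* *m e = 1%:M.
  by apply/matrixP=> i j; rewrite !ord1 mulmx2E !mxE /= conjC0 conjC1; ring.
have unit1 : 1 * 1^* = 1 :> C by rewrite conjC1 mulr1.
have unitN1 : -1 * (-1)^* = 1 :> C by rewrite rmorphN /= conjC1 mulrNN mulr1.
have uniti : 'i * ('i)^* = 1 :> C by rewrite conjCi mulrN -expr2 sqrCi opprK.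
have [p0] := Delta_image e1; set q0 := e *m _ => Dp0.
have [p1 Dp1] := Delta_image (qvec_unit unit1).
have [p2 Dp2] := Delta_image (qvec_unit unitN1).
have [p3 Dp3] := Delta_image (qvec_unit uniti).
have [Delta1 _ _] := qqo.
have [|c c_neq0 /(congr1 Delta)] :=
  @linear_dependent 2 2 5 (fun i => nth 0 [:: 1%:M; p0; p1; p2; p3] i) => //.
rewrite linear0 !big_ord_recl big_ord0 /= !linearD linear0 !linearZ /=.
rewrite Delta1 Dp0 Dp1 Dp2 Dp3 addr0.
have := qvecE 'i; have := qvecE (-1); have := qvecE 1; rewrite /=.
have : [/\ q0 0 0 = 1, q0 0 1 = 0, q0 1 0 = 0 & q0 1 1 = 0].
  by rewrite !mxE !big_ord1 !mxE /= conjC0 conjC1 !(mulr0, mul0r, mulr1).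
(* The four projections become opaque matrices, known only through their recorded entries. *)
move: {Dp0} q0 (qvec 1 *m _) (qvec (-1) *m _) (qvec 'i *m _).
rewrite rmorphN /= conjC1 conjCi => q0 q1 q2 q3.
move=> [a0 b0 c0 d0] [a1 b1 c1 d1] [a2 b2 c2 d2] [a3 b3 c3 d3].
have addE (A B : 'M[C]_(2 * 2)) i j : (A + B) i j = A i j + B i j by rewrite mxE.
have scaleE s (A : 'M[C]_(2 * 2)) i j : (s *: A) i j = s * A i j by rewrite mxE.
have subE (A B : 'M[C]_2) i j : (A - B) i j = A i j - B i j by rewrite !mxE.
have oneE i j : (1%:M : 'M[C]_2) i j = (i == j)%:R by rewrite mxE.
set k0 := c 0 ord0; set k1 := c 0 (lift _ _).
set k2 := c 0 (lift _ _); set k3 := c 0 (lift _ _); set k4 := c 0 (lift _ _).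
move/matrixP => E.
(* Here [(i, j)] indexes the first tensor factor and [(k, l)] the second. *)
have {}E i j k l := E (mxtens_index (i, k)) (mxtens_index (j, l)).
have entries := (addE, scaleE, tensmxE, subE, oneE, a0, a1, a2, a3, b0, b1, b2, b3,
  c0, c1, c2, c3, d0, d1, d2, d3).
have eq0 (s x y : C) : y = 0 -> s != 0 -> y = s * x -> x = 0.
  by move=> -> s0 /esym/eqP; rewrite mulf_eq0 (negPf s0) => /eqP.
have ii : 'i * 'i = -1 :> C by rewrite -expr2 sqrCi.
have nz (m n : nat) : m.+1%:R / n.+1%:R != 0 :> C.
  by rewrite mulf_neq0 ?invr_eq0 ?pnatr_eq0.
(* The entry for parameter [z] is twice the square of [12 / 25 * z^*]. The common factor is 288/625,
   passed to [nz] as 287 and 624 because [nz] takes predecessors. *)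
have hA : k2 + k3 + 'i * 'i * k4 = 0.
  move: (E 0 1 0 1); rewrite !entries mxE => /eq0; apply; first exact: (nz 287%N 624%N).
  by rewrite /=; field.
have hB : k2 + k3 - 'i * 'i * k4 = 0.
  move: (E 0 1 1 0); rewrite !entries mxE => /eq0; apply; first exact: (nz 287%N 624%N).
  by rewrite /=; field.
have hC : k3 - k2 + 'i * k4 = 0.
  move: (E 0 0 0 1); rewrite !entries mxE => /eq0; apply; first exact: (nz 83%N 624%N).
  by rewrite /=; field.
have z4 : k4 = 0.
  apply: (eq0 2 _ _ (erefl 0)); first by rewrite pnatr_eq0.
  by rewrite -[LHS](subrr 0) -{1}hB -hA ii; ring.
have z3 : k3 = 0.
  apply: (eq0 2 _ _ (erefl 0)); first by rewrite pnatr_eq0.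
  by rewrite -[LHS](addr0 0) -{1}hA -hC z4; ring.
have z2 : k2 = 0 by rewrite -[RHS]hA z3 z4; ring.
have z0 : k0 = 0.
  (* With the other coefficients gone, only the image of the identity contributes here: the product
     [q0 0 0 * q0 1 1] and its complementary term both vanish. *)
  by move: (E 0 0 1 1); rewrite !entries mxE z2 z3 z4 /= => <-; ring.
have z1 : k1 = 0.
  by move: (E 0 0 0 0); rewrite !entries mxE z0 z2 z3 z4 /= => <-; ring.
case/eqP: c_neq0; apply/rowP=> i; rewrite mxE.
do 4!(case: (unliftP ord0 i) => [{}i|] -> //).
by rewrite ord1.
Qed.

End Operator.
End Qubit.

Theorem theorem4p3 (R : realType)
  (Delta : {linear 'M[R[i]]_2 -> 'M[R[i]]_(2 * 2)})
  (hqqo : quasi_qqo Delta) (hsym : symmetric_qqo Delta)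
  (hpure : q_pure Delta) (hhaar : haar_state Delta (tau R[i])) :
  ~ positive_map Delta.
Proof. exact: pure_haar_positive_absurd hhaar hqqo hpure. Qed.
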